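(* The problem of finding, in a given graph, a subgraph on $k$ vertices of maximum density (equivalently, a $k$-vertex subgraph with the maximum number of edges) is polynomial-time reducible to the Dota Underlords problem.
   Context: The Dota Underlords (DU) problem. An instance consists of: $n\in\mathbb{N}$ heroes; a maximum team size $m\in\mathbb{N}$; $t\in\mathbb{N}$ alliances; a maximum alliance size $q\in\mathbb{N}$; hero strengths $s_i\in\mathbb{R}$ ($i=1,\dots,n$); an incidence matrix $a_{ij}\in\{0,1\}$ with $a_{ij}=1$ iff hero $i$ belongs to alliance $j$, satisfying $\sum_{i=1}^n a_{ij}\le q$ for every $j$; and bonuses $e_{ijk}\in\mathbb{R}$ ($1\le i\le n$, $1\le j\le t$, $1\le k\le q$), where $e_{ijk}$ is the bonus to hero $i$ when at least $k$ heroes of alliance $j$ are in the team. The problem is the integer program: maximize $\sum_{i=1}^n x_i s_i+\sum_{i=1}^n\sum_{j=1}^t\sum_{k=1}^q e_{ijk}I_{ijk}$ over $x_i\in\{0,1\}$ ($x_i=1$ iff hero $i$ is in the team) and $I_{ijk}\in\{0,1\}$ ($I_{ijk}=1$ iff the $k$-th bonus of alliance $j$ is activated for hero $i$), subject to $\sum_{i=1}^n x_i\le m$; $I_{ijk}\le x_i$ for all $i,j,k$; and $\sum_{i'=1}^n a_{i'j}x_{i'}-k\ge M(I_{ijk}-1)$ for all $i,j,k$, where $M$ is a constant larger than $q$ (so $I_{ijk}=1$ is possible only if the team contains at least $k$ heroes of alliance $j$). The density of a subgraph $G'$ is $|E(G')|/|V(G')|$. *)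

(* Defs.v *)
From HB Require Import structures.
From mathcomp Require Import all_boot all_order all_algebra.
From mathcomp Require Import reals.

Set Implicit Arguments.
Unset Strict Implicit.
Unset Printing Implicit Defensive.

Import Order.TTheory GRing.Theory Num.Theory.

(** * Deterministic multi-tape Turing machines *)

Inductive move := MLeft | MStay | MRight.

(* A machine with K+1 two-way infinite tapes. The finite tape alphabet contains
   the input/output alphabet Sigma (via tm_inj) and a blank outside of it. *)
Record tm (Sigma : finType) (K : nat) := Tm {
  tm_state : finType;
  tm_sym : finType;
  tm_blank : tm_sym;
  tm_inj : Sigma -> tm_sym;
  tm_inj_inj : injective tm_inj;
  tm_inj_blank : forall a, tm_inj a != tm_blank;
  tm_start : tm_state;
  tm_halt : pred tm_state;
  tm_trans : tm_state -> {ffun 'I_K.+1 -> tm_sym} ->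
             tm_state * {ffun 'I_K.+1 -> tm_sym * move} }.

(* The cells strictly to the left of the head, nearest first, and the cells from
   the head rightwards; all the cells beyond the two lists are blank. *)
Record tape (Gamma : Type) := Tape { tleft : seq Gamma; tright : seq Gamma }.

Section Tapes.
Variables (Gamma : Type) (blank : Gamma).

Definition tread (T : tape Gamma) : Gamma := head blank (tright T).

Definition twrite (a : Gamma) (T : tape Gamma) : tape Gamma :=
  Tape (tleft T) (a :: behead (tright T)).

Definition tmove (d : move) (T : tape Gamma) : tape Gamma :=
  match d with
  | MLeft => Tape (behead (tleft T)) (head blank (tleft T) :: tright T)
  | MStay => T
  | MRight => Tape (tread T :: tleft T) (behead (tright T))
  end.

End Tapes.

Section Runs.
Variables (Sigma : finType) (K : nat) (N : tm Sigma K).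

Definition config : Type :=
  (tm_state N * {ffun 'I_K.+1 -> tape (tm_sym N)})%type.

Definition tm_step (c : config) : config :=
  if tm_halt c.1 then c else
  let r := tm_trans c.1 [ffun l => tread (tm_blank N) (c.2 l)] in
  (r.1, [ffun l => tmove (tm_blank N) (r.2 l).2 (twrite (r.2 l).1 (c.2 l))]).

(* The input is on tape 0, with the head on its first symbol. *)
Definition tm_init (w : seq Sigma) : config :=
  (tm_start N,
   [ffun l => if l == ord0 then Tape [::] (map (@tm_inj _ _ N) w)
              else Tape [::] [::]]).

(* The output is read on the last tape, from the head to the first blank. *)
Definition tm_output (c : config) : seq (tm_sym N) :=
  let s := tright (c.2 ord_max) in take (find (pred1 (tm_blank N)) s) s.

Definition tm_computes_in (w : seq Sigma) (time : nat) (v : seq Sigma) : Prop :=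
  let c := iter time tm_step (tm_init w) in
  tm_halt c.1 /\ tm_output c = map (@tm_inj _ _ N) v.

End Runs.

(** * Polynomial-time reductions between search problems *)

Definition symbol : finType := option bool.
Definition word := seq symbol.

Definition polytime (X Y : Type) (encX : X -> word) (encY : Y -> word)
    (h : X -> Y) : Prop :=
  exists (K : nat) (N : tm symbol K) (c d : nat), forall x : X,
    exists2 time : nat, time <= c * size (encX x) ^ d + c &
      tm_computes_in N (encX x) time (encY (h x)).

(* sol x is the type of the candidate answers to x, and is_sol x singles out the
   correct ones (for an optimization problem, the optimal solutions). *)
Record search_problem := SearchProblem {
  inst : Type;
  sol : inst -> Type;
  is_sol : forall x : inst, sol x -> Prop;
  enc_inst : inst -> word;
  enc_sol : forall x : inst, sol x -> word }.

(* f translates instances, and g translates answers back; g has access to the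
   original instance. *)
Definition poly_reducible (A B : search_problem) : Prop :=
  exists (f : inst A -> inst B)
         (g : forall x : inst A, sol (f x) -> sol x),
  [/\ polytime (@enc_inst A) (@enc_inst B) f,
      polytime
        (fun u : {x : inst A & sol (f x)} =>
           enc_inst (tag u) ++ None :: enc_sol (tagged u))
        (fun v : {x : inst A & sol x} => enc_sol (tagged v))
        (fun u => Tagged (@sol A) (g (tag u) (tagged u))),
      forall x : inst A, (exists y : sol x, is_sol y) ->
        exists z : sol (f x), is_sol z
    & forall (x : inst A) (z : sol (f x)), is_sol z -> is_sol (g x z)].

(** * Encodings *)

(* Dimensions and cardinality bounds are written in unary. For the k of a k-vertex
   subgraph, k is at most the order of the graph, whose adjacency matrix is written
   out in full; for the target of a reduction, unary is the stronger requirement,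
   since unary is translated into binary in polynomial time. *)
Definition enc_nat (n : nat) : word := rcons (nseq n (Some true)) None.

Fixpoint pos_bits (p : BinNums.positive) : seq bool :=
  match p with
  | BinNums.xH => [:: true]
  | BinNums.xO p' => false :: pos_bits p'
  | BinNums.xI p' => true :: pos_bits p'
  end.

(* Binary digits, least significant first. *)
Definition nat_bits (n : nat) : seq bool :=
  if bin_of_nat n is BinNums.Npos p then pos_bits p else [::].

Definition enc_bin (n : nat) : word := rcons (map Some (nat_bits n)) None.

Definition enc_rat (r : rat) : word :=
  Some (r < 0)%R :: enc_bin `|numq r|%N ++ enc_bin `|denq r|%N.

Definition enc_bool (b : bool) : word := [:: Some b].

Definition enc_fam (n : nat) (F : 'I_n -> word) : word :=
  flatten [seq F i | i <- enum 'I_n].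

(** * Densest k-vertex subgraph *)

Record graph := Graph {
  order : nat;
  edges : {set {set 'I_order}};
  edges_card2 : forall e, e \in edges -> #|e| = 2 }.

Record subgraph (G : graph) := Subgraph {
  sverts : {set 'I_(order G)};
  sedges : {set {set 'I_(order G)}};
  sedges_sub : sedges \subset edges G;
  sedges_in : forall e, e \in sedges -> e \subset sverts }.

(* Division by zero is zero, so the null subgraph has density 0. *)
Definition density (G : graph) (H : subgraph G) : rat :=
  (#|sedges H|%:R / #|sverts H|%:R)%R.

Definition max_density_subgraph (G : graph) (k : nat) (H : subgraph G) : Prop :=
  #|sverts H| = k /\
  forall H' : subgraph G, #|sverts H'| = k -> (density H' <= density H)%R.

Definition max_edges_subgraph (G : graph) (k : nat) (H : subgraph G) : Prop :=
  #|sverts H| = k /\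
  forall H' : subgraph G, #|sverts H'| = k -> #|sedges H'| <= #|sedges H|.

Record dks_inst := DksInst {
  dks_graph : graph;
  dks_k : nat;
  dks_k_le : dks_k <= order dks_graph }.

Definition enc_adj (n : nat) (E : {set {set 'I_n}}) : word :=
  enc_fam (fun u : 'I_n => enc_fam (fun v : 'I_n => enc_bool ([set u; v] \in E))).

Definition enc_dks_inst (x : dks_inst) : word :=
  enc_nat (order (dks_graph x)) ++ enc_nat (dks_k x) ++
  enc_adj (edges (dks_graph x)).

Definition enc_subgraph (G : graph) (H : subgraph G) : word :=
  enc_fam (fun u : 'I_(order G) => enc_bool (u \in sverts H)) ++
  enc_adj (sedges H).

Definition densest_k_subgraph : search_problem :=
  @SearchProblem dks_inst (fun x => subgraph (dks_graph x))
    (fun x H => max_density_subgraph (dks_k x) H)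
    enc_dks_inst (fun x H => enc_subgraph H).

(** * Dota Underlords *)

Record du_inst (R : Type) := DuInst {
  du_n : nat;
  du_m : nat;
  du_t : nat;
  du_q : nat;
  du_s : 'I_du_n -> R;
  du_a : 'I_du_n -> 'I_du_t -> bool;
  du_a_le : forall j, \sum_(i < du_n) du_a i j <= du_q;
  du_e : 'I_du_n -> 'I_du_t -> 'I_du_q -> R }.

Definition map_du (R S : Type) (phi : R -> S) (D : du_inst R) : du_inst S :=
  @DuInst S (du_n D) (du_m D) (du_t D) (du_q D)
    (fun i => phi (du_s i)) (@du_a R D) (@du_a_le R D)
    (fun i j k => phi (du_e i j k)).

(* The assignments (x, I), before the constraints are imposed. *)
Definition du_sol (R : Type) (D : du_inst R) : Type :=
  ({ffun 'I_(du_n D) -> bool} *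
   {ffun 'I_(du_n D) * 'I_(du_t D) * 'I_(du_q D) -> bool})%type.

Section DotaUnderlords.
Variables (R : realType) (M : nat -> R).
Local Open Scope ring_scope.

(* M gives the constant of the activation constraints as a function of q. The
   ordinal k stands for the bonus number k + 1. *)
Definition du_feasible (D : du_inst R) (y : du_sol D) : Prop :=
  [/\ (\sum_(i < du_n D) y.1 i <= du_m D)%N,
      forall i j k, (y.2 (i, j, k) <= y.1 i)%N
    & forall i j k,
        M (du_q D) * ((y.2 (i, j, k))%:R - 1) <=
        \sum_(i' < du_n D) (du_a i' j)%:R * (y.1 i')%:R - k.+1%:R].

Definition du_value (D : du_inst R) (y : du_sol D) : R :=
  \sum_(i < du_n D) (y.1 i)%:R * du_s i +
  \sum_(i < du_n D) \sum_(j < du_t D) \sum_(k < du_q D)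
    du_e i j k * (y.2 (i, j, k))%:R.

Definition du_optimal (D : du_inst R) (y : du_sol D) : Prop :=
  du_feasible y /\
  forall y' : du_sol D, du_feasible y' -> du_value y' <= du_value y.

End DotaUnderlords.

Definition enc_du_inst (D : du_inst rat) : word :=
  enc_nat (du_n D) ++ enc_nat (du_m D) ++ enc_nat (du_t D) ++ enc_nat (du_q D) ++
  enc_fam (fun i => enc_rat (@du_s _ D i)) ++
  enc_fam (fun i => enc_fam (fun j => enc_bool (@du_a _ D i j))) ++
  enc_fam (fun i => enc_fam (fun j => enc_fam (fun k =>
    enc_rat (@du_e _ D i j k)))).

Definition enc_du_sol (R : Type) (D : du_inst R) (y : du_sol D) : word :=
  enc_fam (fun i => enc_bool (y.1 i)) ++
  enc_fam (fun i => enc_fam (fun j => enc_fam (fun k =>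
    enc_bool (y.2 (i, j, k))))).

(* The inputs of machines are the instances with rational data, which are then read
   as instances over the reals. *)
Definition dota_underlords (R : realType) (M : nat -> R) : search_problem :=
  @SearchProblem (du_inst rat) (fun D => du_sol (map_du (@ratr R) D))
    (fun D y => du_optimal M y)
    enc_du_inst (fun D y => enc_du_sol y).

(* Main.v *)
(** Take a hero of strength 1 for every vertex, and for every vertex [j] an
    alliance whose only member is [j]. Its only bonus, for the hero [i], is the
    adjacency of [i] and [j]; it can be activated exactly when [i] and [j] are both
    in the team. A team [T] thus has value at most [#|T|] plus twice the number of
    edges inside [T], with equality for a suitable activation, and the strengths
    force an optimal team to have the full size [k]: optimal teams induce the
    [k]-vertex subgraphs with the most edges.

    Both translations are computed by explicit four-tape machines, whose runs are
    followed on zippers and have a length linear in the size of the input. *)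

From HB Require Import structures.
From mathcomp Require Import all_boot all_order all_algebra.
From mathcomp Require Import reals zify.
Require Import Defs.

Set Implicit Arguments.
Unset Strict Implicit.
Unset Printing Implicit Defensive.

Import Order.TTheory GRing.Theory Num.Theory.

(** * Four-tape machines *)

Definition cell : finType := option symbol.
Notation blank := None (only parsing).
Notation hash := (Some None) (only parsing).
Notation bit b := (Some (Some b)).
Notation tick := (Some (Some true)).

(* A zipper always shows the scanned cell, so that rewriting a cell in place is the
   identity, which fails for a tape whose right part is empty. *)
Record zipper := Zipper { zleft : seq cell; zcur : cell; zright : seq cell }.

(** An exhausted right part is shown as a scanned blank, so [tp l [::]] and [tp l [:: blank]] are
    the same zipper. *)
Definition tp (l s : seq cell) : zipper := Zipper l (head blank s) (behead s).

Definition act (m : cell * move) (T : zipper) : zipper :=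
  match m.2 with
  | MLeft => Zipper (behead (zleft T)) (head blank (zleft T)) (m.1 :: zright T)
  | MStay => Zipper (zleft T) m.1 (zright T)
  | MRight => tp (m.1 :: zleft T) (zright T)
  end.

Definition zipper_of (T : tape cell) : zipper := tp (tleft T) (tright T).

Lemma zipper_of_act (m : cell * move) (T : tape cell) :
  zipper_of (tmove blank m.2 (twrite m.1 T)) = act m (zipper_of T).
Proof. by case: m => a []; case: T => l r. Qed.

(** * Runs with a bounded number of steps *)

Section Reach.
Variables (C : Type) (step : C -> C).

(** An upper bound rather than an exact count, so that branches of different lengths share one
    estimate. *)
Definition reach (b : nat) (x y : C) : Prop :=
  exists2 t, t <= b & iter t step x = y.

Lemma reach0 b x : reach b x x.
Proof. by exists 0. Qed.

Lemma reach_leq b1 b2 x y : b1 <= b2 -> reach b1 x y -> reach b2 x y.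
Proof. by move=> le12 [t le_tb1 <-]; exists t; rewrite ?(leq_trans le_tb1). Qed.

Lemma reachS b x y : reach b (step x) y -> reach b.+1 x y.
Proof. by case=> t le_tb <-; exists t.+1; rewrite // iterSr. Qed.

Lemma reach_trans b1 b2 x y z :
  reach b1 x y -> reach b2 y z -> reach (b1 + b2) x z.
Proof.
move=> [t1 le1 <-] [t2 le2 <-]; exists (t2 + t1); last by rewrite iterD.
by rewrite addnC leq_add.
Qed.

End Reach.

(** * Simulation of four-tape machines on zippers *)

Section FourTapes.
Variables (Q : finType) (q0 : Q) (halt : pred Q).
Variable delta : Q -> cell -> cell -> cell -> cell ->
  Q * (cell * move) * (cell * move) * (cell * move) * (cell * move).

(** The four tapes are separate components instead of a finite function, so that a step on concrete
    cells reduces by computation. *)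
Definition step4 (c : Q * zipper * zipper * zipper * zipper) :=
  let: (q, T0, T1, T2, T3) := c in
  if halt q then c else
  let: (q', m0, m1, m2, m3) :=
    delta q (zcur T0) (zcur T1) (zcur T2) (zcur T3) in
  (q', act m0 T0, act m1 T1, act m2 T2, act m3 T3).

Notation o k := (@Ordinal 4 k isT).

Definition trans4 (q : Q) (a : {ffun 'I_4 -> cell}) :
    Q * {ffun 'I_4 -> cell * move} :=
  let: (q', m0, m1, m2, m3) := delta q (a (o 0)) (a (o 1)) (a (o 2)) (a (o 3)) in
  (q', [ffun l : 'I_4 => nth m0 [:: m0; m1; m2; m3] l]).

Definition tm4 : tm symbol 3 :=
  @Tm symbol 3 Q cell blank Some Some_inj (fun=> isT) q0 halt trans4.

Definition zippers_of (c : config tm4) : Q * zipper * zipper * zipper * zipper :=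
  (c.1, zipper_of (c.2 (o 0)), zipper_of (c.2 (o 1)), zipper_of (c.2 (o 2)),
   zipper_of (c.2 (o 3))).

Lemma zippers_of_step (c : config tm4) :
  zippers_of (tm_step c) = step4 (zippers_of c).
Proof.
rewrite /zippers_of /tm_step /step4 /=; case: ifP => // _.
rewrite /trans4 !ffunE /= /tread.
case: (delta _ _ _ _ _) => [[[[q m0] m1] m2] m3] /=.
by rewrite !ffunE /= !zipper_of_act.
Qed.

(** Transfers a zipper run to the machine itself: by [zippers_of_step] the two runs agree step by
    step. *)
Lemma tm4_computes (w v : word) (b : nat) (q : Q) (T0 T1 T2 : zipper)
    (l r : seq cell) :
  reach step4 b (q0, tp [::] (map Some w), tp [::] [::], tp [::] [::], tp [::] [::])
    (q, T0, T1, T2, tp l (map Some v ++ blank :: r)) ->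
  halt q ->
  exists2 time, time <= b & tm_computes_in tm4 w time v.
Proof.
move=> [t le_tb tE] hq; exists t => //.
have runE: zippers_of (iter t (@tm_step _ _ tm4) (tm_init tm4 w)) =
    (q, T0, T1, T2, tp l (map Some v ++ blank :: r)).
  rewrite -tE; elim: t {le_tb tE} => [|t IHt] /=.
    by rewrite /zippers_of /= !ffunE.
  by rewrite zippers_of_step IHt.
rewrite /tm_computes_in; move: (iter _ _ _) runE => c [qE _ _ _ _ hd bh].
rewrite /= qE; split=> //.
rewrite /tm_output (_ : ord_max = o 3); last exact: val_inj.
case: (c.2 (o 3)) hd bh => l' s /= {tE le_tb}.
(* The actual right part may be empty where the zipper shows a blank; then [v] is empty. *)
case: s => [|a s] /=; first by case: v.
move=> -> ->; case: v => [|x v] //=.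
congr (_ :: _); elim: v => [|y v IHv] //=.
by rewrite IHv.
Qed.

End FourTapes.

(** * The machine producing the instance *)

Inductive fstate :=
  CopyN | CopyK | CopyT | PutOne1 | PutOne2 | S0 | S1 | S2 | S3 | S4
| D0 | D1 | DScan | DBack | A0 | A1 | A2 | A3 | A4 | FRewind | FHalt.

Definition fstates := [::
  CopyN; CopyK; CopyT; PutOne1; PutOne2; S0; S1; S2; S3; S4;
  D0; D1; DScan; DBack; A0; A1; A2; A3; A4; FRewind; FHalt].

Definition fstate_code (q : fstate) : nat :=
  match q with
  | CopyN => 0 | CopyK => 1 | CopyT => 2 | PutOne1 => 3 | PutOne2 => 4
  | S0 => 5 | S1 => 6 | S2 => 7 | S3 => 8 | S4 => 9
  | D0 => 10 | D1 => 11 | DScan => 12 | DBack => 13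
  | A0 => 14 | A1 => 15 | A2 => 16 | A3 => 17 | A4 => 18
  | FRewind => 19 | FHalt => 20
  end.

Lemma fstate_codeK : cancel fstate_code (nth FHalt fstates).
Proof. by case. Qed.

HB.instance Definition _ := Countable.copy fstate (can_type fstate_codeK).

Lemma fstates_enum : Finite.axiom fstates.
Proof. by case. Qed.

HB.instance Definition _ := isFinite.Build fstate fstates_enum.

Notation "a >>" := ((a : cell), MRight) (at level 5).
Notation "a <<" := ((a : cell), MLeft) (at level 5).
Notation "a ^^" := ((a : cell), MStay) (at level 5).

(* Tape 0 is the input, tape 3 the output, and the tapes 1 and 2 hold [n] in unary.
   [S0]-[S4] write the strengths, [D0]-[DBack] the incidence matrix, and [A0]-[A4]
   the bonuses. *)
Definition fdelta (q : fstate) (i w v o : cell) :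
    fstate * (cell * move) * (cell * move) * (cell * move) * (cell * move) :=
  match q with
  | CopyN => if i is tick then (CopyN, i>>, tick>>, tick>>, tick>>)
             else (CopyK, i>>, w^^, v^^, hash>>)
  | CopyK => if i is tick then (CopyK, i>>, w^^, v^^, tick>>)
             else (CopyT, i>>, w<<, v<<, hash>>)
  | CopyT => if w is tick then (CopyT, i^^, w<<, v<<, tick>>)
             else (PutOne1, i^^, w>>, v>>, hash>>)
  | PutOne1 => (PutOne2, i^^, w^^, v^^, tick>>)
  | PutOne2 => (S0, i^^, w^^, v^^, hash>>)
  | S0 => if w is tick then (S1, i^^, w^^, v^^, (bit false)>>)
          else (D0, i^^, w^^, v^^, o^^)
  | S1 => (S2, i^^, w^^, v^^, tick>>)
  | S2 => (S3, i^^, w^^, v^^, hash>>)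
  | S3 => (S4, i^^, w^^, v^^, tick>>)
  | S4 => (S0, i^^, w>>, v^^, hash>>)
  | D0 => if v is tick then (D1, i^^, w^^, v>>, tick>>)
          else (A0, i^^, w^^, v^^, o^^)
  | D1 => if v is tick then (DScan, i^^, w<<, v^^, o^^)
          else (A0, i^^, w^^, v^^, o^^)
  | DScan => if w is tick then (DScan, i^^, w<<, v^^, (bit false)>>)
             else (DBack, i^^, w>>, v^^, o^^)
  | DBack => if w is tick then (DBack, i^^, w>>, v^^, o^^)
             else (D0, i^^, w^^, v^^, o^^)
  | A0 => if i is bit _ then (A1, i^^, w^^, v^^, (bit false)>>)
          else (FRewind, i^^, w^^, v^^, o<<)
  | A1 => if i is tick then (A2, i^^, w^^, v^^, tick>>)
          else (A3, i^^, w^^, v^^, hash>>)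
  | A2 => (A3, i^^, w^^, v^^, hash>>)
  | A3 => (A4, i^^, w^^, v^^, tick>>)
  | A4 => (A0, i>>, w^^, v^^, hash>>)
  | FRewind => if o is Some _ then (FRewind, i^^, w^^, v^^, o<<)
               else (FHalt, i^^, w^^, v^^, o>>)
  | FHalt => (FHalt, i^^, w^^, v^^, o^^)
  end.

Definition fhalt (q : fstate) : bool := if q is FHalt then true else false.

Local Notation freach := (reach (step4 fhalt fdelta)).

Lemma nseq_catS T n (a : T) s : nseq n a ++ a :: s = nseq n.+1 a ++ s.
Proof. by elim: n => //= n ->. Qed.

(** As in the other run lemmas, the cells already passed are arbitrary, which lets the induction
    move cells onto them. *)
Lemma freach_CopyN n l s lw lv lo :
  freach n.+1
    (CopyN, tp l (nseq n tick ++ hash :: s), tp lw [::], tp lv [::], tp lo [::])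
    (CopyK, tp (hash :: nseq n tick ++ l) s, tp (nseq n tick ++ lw) [::],
      tp (nseq n tick ++ lv) [::], tp (hash :: nseq n tick ++ lo) [::]).
Proof.
elim: n l lw lv lo => [|n IHn] l lw lv lo; first exact/reachS/reach0.
apply: reachS.
move: IHn => /(_ (tick :: l) (tick :: lw) (tick :: lv) (tick :: lo)).
by rewrite !nseq_catS.
Qed.

Lemma freach_CopyK k l s lw sw lv sv lo :
  freach k.+1
    (CopyK, tp l (nseq k tick ++ hash :: s), tp lw sw, tp lv sv, tp lo [::])
    (CopyT, tp (hash :: nseq k tick ++ l) s,
      tp (behead lw) (head blank lw :: head blank sw :: behead sw),
      tp (behead lv) (head blank lv :: head blank sv :: behead sv),
      tp (hash :: nseq k tick ++ lo) [::]).
Proof.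
elim: k l lo => [|k IHk] l lo; first exact/reachS/reach0.
by apply: reachS; move: IHk => /(_ (tick :: l) (tick :: lo)); rewrite !nseq_catS.
Qed.

(** Writes [t = n] while rewinding tapes 1 and 2; splitting each block into [head] and [behead]
    covers [n = 0]. *)
Lemma freach_CopyT n T sw sv lo :
  freach n.+1
    (CopyT, T, tp (behead (nseq n tick)) (head blank (nseq n tick) :: sw),
      tp (behead (nseq n tick)) (head blank (nseq n tick) :: sv), tp lo [::])
    (PutOne1, T, tp [:: blank] (nseq n tick ++ sw),
      tp [:: blank] (nseq n tick ++ sv), tp (hash :: nseq n tick ++ lo) [::]).
Proof.
case: T => l c r; elim: n sw sv lo => [|n IHn] sw sv lo.
  exact/reachS/reach0.
apply: reachS; move: IHn => /(_ (tick :: sw) (tick :: sv) (tick :: lo)).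
by rewrite !nseq_catS.
Qed.

(** The encodings of the rationals 1 and 0: sign flag, numerator digits, [None], denominator digits,
    [None]. The numerator 0 has no digits. *)
Definition rat1_word : word := [:: Some false; Some true; None; Some true; None].
Definition rat0_word : word := [:: Some false; None; Some true; None].

Lemma freach_S0 n T lw sw U lo :
  freach (5 * n).+1
    (S0, T, tp lw (nseq n tick ++ blank :: sw), U, tp lo [::])
    (D0, T, tp (nseq n tick ++ lw) (blank :: sw), U,
      tp (catrev (map Some (flatten (nseq n rat1_word))) lo) [::]).
Proof.
case: T U => l c r [l' c' r']; elim: n lw lo => [|n IHn] lw lo.
  exact/reachS/reach0.
rewrite mulnS; do 5 apply: reachS.
move: IHn => /(_ (tick :: lw) (catrev (map Some rat1_word) lo)).
by rewrite nseq_catS.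
Qed.

Lemma freach_DScan n T lw sw U lo :
  freach n.+1
    (DScan, T, tp (behead (nseq n tick ++ blank :: lw))
       (head blank (nseq n tick ++ blank :: lw) :: sw), U, tp lo [::])
    (DBack, T, tp (blank :: lw) (nseq n tick ++ sw), U,
      tp (catrev (nseq n (bit false)) lo) [::]).
Proof.
case: T U => l c r [l' c' r']; elim: n sw lo => [|n IHn] sw lo.
  exact/reachS/reach0.
apply: reachS; move: IHn => /(_ (tick :: sw) (bit false :: lo)).
by rewrite !nseq_catS.
Qed.

Lemma freach_DBack n T lw sw U l a :
  freach n.+1
    (DBack, T, tp lw (nseq n tick ++ blank :: sw), U, tp l a)
    (D0, T, tp (nseq n tick ++ lw) (blank :: sw), U, tp l a).
Proof.
case: T U => l0 c r [l' c' r']; elim: n lw => [|n IHn] lw.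
  exact/reachS/reach0.
by apply: reachS; move: IHn => /(_ (tick :: lw)); rewrite !nseq_catS.
Qed.

(* The periodic word [1 0^n 1 0^n ... 1] lists the rows of the identity matrix. *)
Lemma freach_D0 m n T lw sw lv sv lo :
  freach (m * (2 * n + 4)).+2
    (D0, T, tp (nseq n tick ++ blank :: lw) (blank :: sw),
      tp lv (nseq m tick ++ blank :: sv), tp lo [::])
    (A0, T, tp (nseq n tick ++ blank :: lw) (blank :: sw),
      tp (nseq m tick ++ lv) (blank :: sv),
      tp (catrev (map Some (map Some
        (flatten (nseq m.-1 (true :: nseq n false)) ++ nseq (m > 0) true))) lo)
      [::]).
Proof.
case: T => l c r; elim: m lv lo => [|m IHm] lv lo.
  exact/reachS/reach0.
(* After the last 1 no zeros follow: [D1] meets the end of tape 2 at once. *)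
case: m IHm => [|m] IHm.
  exact/reachS/reachS/reach0.
(* A period costs the two steps [D0] and [D1], then a pass over tape 1 in each direction, of [n + 1]
   steps. *)
have -> : (m.+2 * (2 * n + 4)).+2 =
    (n.+1 + (n.+1 + (m.+1 * (2 * n + 4)).+2)).+2 by lia.
apply/reachS/reachS/(reach_trans (freach_DScan _ _ _ _ _ _)).
apply: reach_trans (freach_DBack _ _ _ _ _ _ _) _.
move: IHm => /(_ (tick :: lv) (catrev (nseq n (bit false)) (tick :: lo))).
rewrite nseq_catS /= !map_cat !map_nseq -!catA !catrevE !rev_cat.
by rewrite !rev_cons -!cats1 -!catA.
Qed.

Lemma freach_A0 (bs : seq bool) l U V lo :
  freach (5 * size bs).+1
    (A0, tp l (map Some (map Some bs)), U, V, tp lo [::])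
    (FRewind, tp (catrev (map Some (map Some bs)) l) [::], U, V,
      tp (behead (catrev (map Some (flatten
           [seq if b then rat1_word else rat0_word | b <- bs])) lo))
        [:: head blank (catrev (map Some (flatten
           [seq if b then rat1_word else rat0_word | b <- bs])) lo); blank]).
Proof.
case: U V => lu cu ru [lv cv rv]; elim: bs l lo => [|b bs IHbs] l lo.
  exact/reachS/reach0.
rewrite mulnS; case: b; do 4 apply: reachS.
  by apply: reachS; apply: IHbs.
(* A zero entry skips [A2] and takes four steps instead of five. *)
by apply: reach_leq (IHbs _ _).
Qed.

(** The left part lists the nearest cells first, so [w] is the output reversed; none of its cells is
    blank, and the rewind stops exactly at its end. *)
Lemma freach_FRewind (w : word) T U V s :
  freach (size w).+1
    (FRewind, T, U, V, tp (behead (map Some w)) (head blank (map Some w) :: s))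
    (FHalt, T, U, V, tp [:: blank] (catrev (map Some w) s)).
Proof.
case: T U V => l c r [lu cu ru] [lv cv rv]; elim: w s => [|a w IHw] s.
  exact/reachS/reach0.
by apply: reachS; apply: IHw.
Qed.

(** The output in the order of writing: [n], [m = k], [t = n], [q = 1], strengths, incidence matrix,
    bonuses, where [bs] is the adjacency matrix of the graph. *)
Definition fword (n k : nat) (bs : seq bool) : word :=
  enc_nat n ++ enc_nat k ++ enc_nat n ++ enc_nat 1 ++ flatten (nseq n rat1_word)
  ++ map Some (flatten (nseq n.-1 (true :: nseq n false)) ++ nseq (n > 0) true)
  ++ flatten [seq if b then rat1_word else rat0_word | b <- bs].

(** Bounds the cost of the final rewind, which passes over the whole output. *)
Lemma size_fword n k (bs : seq bool) :
  size (fword n k bs) <= 10 + 7 * n + k + n * n.+1 + 5 * size bs.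
Proof.
have size_I : size (flatten (nseq n.-1 (true :: nseq n false))) <= n * n.+1.
  apply: leq_trans (leq_mul (leq_pred n) (leqnn n.+1)).
  by elim: n.-1 => //= p IHp; rewrite size_cat size_nseq mulSn addSn ltnS leq_add2l.
have size_s : size (flatten (nseq n rat1_word)) = 5 * n.
  by elim: (n) => //= p ->; rewrite mulnS.
have size_e : size (flatten [seq if b then rat1_word else rat0_word | b <- bs])
    <= 5 * size bs.
  elim: bs => [|[] bs IHbs] //; rewrite mulnS.
    exact: leq_add (leqnn 5) IHbs.
  exact: leq_add (isT : 4 <= 5) IHbs.
rewrite /fword !size_cat size_map size_cat !size_rcons !size_nseq size_s.
by case: (n > 0); lia.
Qed.

Lemma fmachine_computes n k (bs : seq bool) :
  exists2 time, time <= 50 * (n + k + n * n + size bs).+1 &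
    tm_computes_in (tm4 CopyN fhalt fdelta)
      (enc_nat n ++ enc_nat k ++ map Some bs) time (fword n k bs).
Proof.
have := size_fword n k bs.
set N := size _ => leN.
(* The summands are the bounds of the successive phases; the 2 stands for writing [q = 1]. *)
suff: exists T U V, reach (step4 fhalt fdelta)
    (n.+1 + (k.+1 + (n.+1 + (2 + ((5 * n).+1 + ((n * (2 * n + 4)).+2 +
      ((5 * size bs).+1 + N.+1)))))))
    (CopyN, tp [::] (map Some (enc_nat n ++ enc_nat k ++ map Some bs)),
      tp [::] [::], tp [::] [::], tp [::] [::])
    (FHalt, T, U, V, tp [:: blank] (map Some (fword n k bs) ++ [:: blank])).
  move=> [T [U [V run]]].
  have [time le_t comp] := tm4_computes run isT.
  exists time => //; apply: leq_trans le_t _; lia.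
do 3 eexists; rewrite !map_cat !map_rcons !map_nseq -!cats1 -!catA.
apply: reach_trans (freach_CopyN _ _ _ _ _ _) _.
apply: reach_trans (freach_CopyK _ _ _ _ _ _ _ _) _.
rewrite !cats0.
apply: reach_trans (freach_CopyT _ _ _ _ _) _.
apply: (@reach_trans _ _ 2); first exact/reachS/reachS/reach0.
apply: reach_trans (freach_S0 _ _ _ _ _ _) _.
apply: reach_trans (freach_D0 _ _ _ _ _ _ _ _) _.
apply: reach_trans (freach_A0 _ _ _ _ _) _.
set out := catrev [seq Some i | i <- flatten _] _.
(* Everything written so far lies to the left of the head, hence in reverse order. *)
have -> : out = map Some (rev (fword n k bs)).
  rewrite /out /fword map_rev !map_cat !map_rcons !map_nseq /=.
  by rewrite !catrevE !(rev_cat, rev_rcons, rev_cons, rev_nseq, cat_rcons) -!catA.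
have -> : reach (step4 fhalt fdelta) N.+1 = reach (step4 fhalt fdelta)
    (size (rev (fword n k bs))).+1 by rewrite size_rev.
have := freach_FRewind (rev (fword n k bs)) _ _ _ [:: None].
rewrite catrevE -map_rev revK /fword !map_cat !map_rcons !map_nseq.
rewrite -!cats1 -!catA; exact.
Qed.

(** * The machine translating answers back *)

Inductive gstate :=
  SkipN | RewindVW | SkipK | SkipAdj | CopyX | RewindX | BackX | BackAdj
| Row | Entry | RewindW | GRewind | GHalt.

Definition gstates := [::
  SkipN; RewindVW; SkipK; SkipAdj; CopyX; RewindX; BackX; BackAdj;
  Row; Entry; RewindW; GRewind; GHalt].

Definition gstate_code (q : gstate) : nat :=
  match q with
  | SkipN => 0 | RewindVW => 1 | SkipK => 2 | SkipAdj => 3 | CopyX => 4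
  | RewindX => 5 | BackX => 6 | BackAdj => 7 | Row => 8 | Entry => 9
  | RewindW => 10 | GRewind => 11 | GHalt => 12
  end.

Lemma gstate_codeK : cancel gstate_code (nth GHalt gstates).
Proof. by case. Qed.

HB.instance Definition _ := Countable.copy gstate (can_type gstate_codeK).

Lemma gstates_enum : Finite.axiom gstates.
Proof. by case. Qed.

HB.instance Definition _ := isFinite.Build gstate gstates_enum.

(** An adjacency bit survives when both end vertices are in the team; the blank is a default for
    cells that are not bits. *)
Definition entry_cell (i w v : cell) : cell :=
  if (i, w, v) is (bit a, bit x, bit y) then bit (a && (y && x)) else None.

(* The tapes 1 and 2 hold two copies of the team, scanned along the columns and the
   rows of the adjacency matrix, which is read on tape 0. *)
Definition gdelta (q : gstate) (i w v o : cell) :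
    gstate * (cell * move) * (cell * move) * (cell * move) * (cell * move) :=
  match q with
  | SkipN => if i is tick then (SkipN, i>>, tick>>, tick>>, o^^)
             else (RewindVW, i>>, w<<, v<<, o^^)
  | RewindVW => if w is tick then (RewindVW, i^^, w<<, v<<, o^^)
                else (SkipK, i^^, w>>, v>>, o^^)
  | SkipK => if i is tick then (SkipK, i>>, w^^, v^^, o^^)
             else (SkipAdj, i>>, w^^, v^^, o^^)
  | SkipAdj => if i is bit _ then (SkipAdj, i>>, w^^, v^^, o^^)
               else (CopyX, i>>, w^^, v^^, o^^)
  | CopyX => if w is Some _ then (CopyX, i>>, i>>, i>>, i>>)
             else (RewindX, i<<, w<<, v<<, o^^)
  | RewindX => if w is Some _ then (RewindX, i^^, w<<, v<<, o^^)
               else (BackX, i^^, w>>, v>>, o^^)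
  | BackX => if i is bit _ then (BackX, i<<, w^^, v^^, o^^)
             else (BackAdj, i<<, w^^, v^^, o^^)
  | BackAdj => if i is bit _ then (BackAdj, i<<, w^^, v^^, o^^)
               else (Row, i>>, w^^, v^^, o^^)
  | Row => if v is Some _ then (Entry, i^^, w^^, v^^, o^^)
           else (GRewind, i^^, w^^, v^^, o<<)
  | Entry => if w is Some _ then (Entry, i>>, w>>, v^^, (entry_cell i w v)>>)
             else (RewindW, i^^, w<<, v^^, o^^)
  | RewindW => if w is Some _ then (RewindW, i^^, w<<, v^^, o^^)
               else (Row, i^^, w>>, v>>, o^^)
  | GRewind => if o is Some _ then (GRewind, i^^, w^^, v^^, o<<)
               else (GHalt, i^^, w^^, v^^, o>>)
  | GHalt => (GHalt, i^^, w^^, v^^, o^^)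
  end.

Definition ghalt (q : gstate) : bool := if q is GHalt then true else false.

Local Notation greach := (reach (step4 ghalt gdelta)).
Local Notation bits s := (map Some (map Some s)).

Lemma greach_SkipN n l s lw lv T :
  greach n.+1
    (SkipN, tp l (nseq n tick ++ hash :: s), tp lw [::], tp lv [::], T)
    (RewindVW, tp (hash :: nseq n tick ++ l) s,
      tp (behead (nseq n tick ++ lw)) [:: head None (nseq n tick ++ lw); None],
      tp (behead (nseq n tick ++ lv)) [:: head None (nseq n tick ++ lv); None],
      T).
Proof.
case: T => lo co ro; elim: n l lw lv => [|n IHn] l lw lv.
  exact/reachS/reach0.
apply: reachS; move: IHn => /(_ (tick :: l) (tick :: lw) (tick :: lv)).
by rewrite !nseq_catS.
Qed.

Lemma greach_RewindVW n T sw sv U :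
  greach n.+1
    (RewindVW, T, tp (behead (nseq n tick)) (head None (nseq n tick) :: sw),
      tp (behead (nseq n tick)) (head None (nseq n tick) :: sv), U)
    (SkipK, T, tp [:: None] (nseq n tick ++ sw),
      tp [:: None] (nseq n tick ++ sv), U).
Proof.
case: T U => l c r [lo co ro]; elim: n sw sv => [|n IHn] sw sv.
  exact/reachS/reach0.
apply: reachS; move: IHn => /(_ (tick :: sw) (tick :: sv)).
by rewrite !nseq_catS.
Qed.

Lemma greach_SkipK k l s U V T :
  greach k.+1
    (SkipK, tp l (nseq k tick ++ hash :: s), U, V, T)
    (SkipAdj, tp (hash :: nseq k tick ++ l) s, U, V, T).
Proof.
case: T U V => l0 c0 r0 [l1 c1 r1] [l2 c2 r2]; elim: k l => [|k IHk] l.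
  exact/reachS/reach0.
by apply: reachS; move: IHk => /(_ (tick :: l)); rewrite !nseq_catS.
Qed.

Lemma greach_SkipAdj (bs : seq bool) l s U V T :
  greach (size bs).+1
    (SkipAdj, tp l (bits bs ++ hash :: s), U, V, T)
    (CopyX, tp (hash :: catrev (bits bs) l) s, U, V, T).
Proof.
case: T U V => l0 c0 r0 [l1 c1 r1] [l2 c2 r2]; elim: bs l => [|b bs IHb] l.
  exact/reachS/reach0.
by apply: reachS; apply: IHb.
Qed.

(** No separator ends the team in the input: the [n] ticks prepared on tapes 1 and 2 count its bits
    and are overwritten by them. Tape 3 receives the vertex set of the answer. *)
Lemma greach_CopyX (xs : seq bool) l s lw sw lv sv lo :
  greach (size xs).+1
    (CopyX, tp l (bits xs ++ s), tp lw (nseq (size xs) tick ++ None :: sw),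
      tp lv (nseq (size xs) tick ++ None :: sv), tp lo [::])
    (RewindX, tp (behead (catrev (bits xs) l))
        [:: head None (catrev (bits xs) l), head None s & behead s],
      tp (behead (catrev (bits xs) lw))
        [:: head None (catrev (bits xs) lw), None & sw],
      tp (behead (catrev (bits xs) lv))
        [:: head None (catrev (bits xs) lv), None & sv],
      tp (catrev (bits xs) lo) [::]).
Proof.
elim: xs l lw lv lo => [|x xs IHx] l lw lv lo; first exact/reachS/reach0.
by apply: reachS; apply: IHx.
Qed.

(** Only tape 1 is tested, and the equal lengths bring tape 2 back to its start as well. *)
Lemma greach_RewindX (xs ys : seq bool) T lw sw lv sv U :
  size xs = size ys ->
  greach (size xs).+1
    (RewindX, T,
      tp (behead (bits xs ++ None :: lw))
        (head None (bits xs ++ None :: lw) :: sw),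
      tp (behead (bits ys ++ None :: lv))
        (head None (bits ys ++ None :: lv) :: sv), U)
    (BackX, T, tp (None :: lw) (catrev (bits xs) sw),
      tp (None :: lv) (catrev (bits ys) sv), U).
Proof.
case: T U => l c r [lo co ro].
elim: xs ys sw sv => [|x xs IHx] [|y ys] // sw sv.
  by move=> _; apply/reachS/reach0.
by case=> eq_size; apply: reachS; apply: IHx.
Qed.

(** The matrix precedes the team in the input but follows it in the output, so tape 0 is rewound:
    over the team to the separator, then over the matrix. *)
Lemma greach_BackX (xs : seq bool) l s U V T :
  greach (size xs).+1
    (BackX, tp (behead (bits xs ++ hash :: l))
        (head None (bits xs ++ hash :: l) :: s),
      U, V, T)
    (BackAdj, tp (behead l) [:: head None l, hash & catrev (bits xs) s], U, V, T).
Proof.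
case: T U V => l0 c0 r0 [l1 c1 r1] [l2 c2 r2]; elim: xs s => [|x xs IHx] s.
  exact/reachS/reach0.
by apply: reachS; apply: IHx.
Qed.

Lemma greach_BackAdj (bs : seq bool) l s U V T :
  greach (size bs).+1
    (BackAdj, tp (behead (bits bs ++ hash :: l))
        (head None (bits bs ++ hash :: l) :: s),
      U, V, T)
    (Row, tp (hash :: l) (catrev (bits bs) s), U, V, T).
Proof.
case: T U V => l0 c0 r0 [l1 c1 r1] [l2 c2 r2]; elim: bs s => [|b bs IHb] s.
  exact/reachS/reach0.
by apply: reachS; apply: IHb.
Qed.

(** One row of the matrix: tape 2 stays on the bit [y] of the row vertex while tapes 0 and 1 advance
    together. *)
Lemma greach_Entry (I : Type) (a : I -> bool) (x : I -> bool) (y : bool) (vs : seq I)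
    l s lw lv sv lo :
  greach (size vs).+1
    (Entry, tp l (bits (map a vs) ++ s), tp lw (bits (map x vs) ++ [:: None]),
      tp lv (bit y :: sv), tp lo [::])
    (RewindW, tp (catrev (bits (map a vs)) l) s,
      tp (behead (catrev (bits (map x vs)) lw))
        [:: head None (catrev (bits (map x vs)) lw); None],
      tp lv (bit y :: sv),
      tp (catrev (bits [seq a v && (y && x v) | v <- vs]) lo) [::]).
Proof.
elim: vs l lw lo => [|v vs IHv] l lw lo; first exact/reachS/reach0.
by apply: reachS; apply: IHv.
Qed.

Lemma greach_RewindW (xs : seq bool) T lw sw c lv sv U :
  greach (size xs).+1
    (RewindW, T,
      tp (behead (bits xs ++ None :: lw))
        (head None (bits xs ++ None :: lw) :: sw),
      tp lv (c :: sv), U)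
    (Row, T, tp (None :: lw) (catrev (bits xs) sw), tp (c :: lv) sv, U).
Proof.
case: T U => l c0 r [lo co ro]; elim: xs sw => [|x xs IHx] sw.
  exact/reachS/reach0.
by apply: reachS; apply: IHx.
Qed.

(** Rows [us] and columns [vs] are separate, so that the induction on the rows keeps the columns
    fixed. *)
Lemma greach_Row (I : Type) (a : I -> I -> bool) (x : I -> bool) (us vs : seq I)
    l s lw lv lo :
  let lo' := catrev (bits [seq a u v && (x u && x v) | u <- us, v <- vs]) lo in
  exists T U V,
  greach (size us * (2 * size vs + 3)).+1
    (Row, tp l (bits [seq a u v | u <- us, v <- vs] ++ s),
      tp (None :: lw) (bits (map x vs) ++ [:: None]),
      tp lv (bits (map x us) ++ [:: None]), tp lo [::])
    (GRewind, T, U, V, tp (behead lo') [:: head None lo'; None]).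
Proof.
elim: us l lv lo => [|u us IHu] l lv lo /=.
  by do 3 eexists; apply/reachS/reach0.
rewrite !map_cat !catrevE !rev_cat -!catA -!catrevE.
have [T [U [V]]] := IHu (catrev (bits (map (a u) vs)) l) (bit (x u) :: lv)
  (catrev (bits [seq a u v && (x u && x v) | v <- vs]) lo).
move=> run; exists T, U, V.
(* A row costs one step in [Row] and two passes of [size vs + 1] steps. *)
apply: (@reach_leq _ _ ((size vs).+1 + ((size vs).+1 +
  (size us * (2 * size vs + 3)).+1)).+1).
  by rewrite (mulSn (size us)); move: (size us * _) => N; lia.
apply: reachS.
apply: reach_trans (greach_Entry _ _ _ _ _ _ _ _ _ _) _.
apply: reach_trans run.
rewrite -[X in reach _ X.+1](size_map x) -size_rev catrevE -!map_rev.
have rewind T' := greach_RewindW (rev (map x vs)) T' lw [:: None].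
rewrite -!map_rev catrevE -!map_rev revK in rewind.
by rewrite /= !catrevE -!map_rev; apply: rewind.
Qed.

Lemma greach_GRewind (w : word) T U V s :
  greach (size w).+1
    (GRewind, T, U, V, tp (behead (map Some w)) (head None (map Some w) :: s))
    (GHalt, T, U, V, tp [:: None] (catrev (map Some w) s)).
Proof.
case: T U V => l c r [lu cu ru] [lv cv rv]; elim: w s => [|a w IHw] s.
  exact/reachS/reach0.
by apply: reachS; apply: IHw.
Qed.

Definition gword (I : Type) (a : I -> I -> bool) (x : I -> bool) (vs : seq I) : word :=
  map Some (map x vs ++ [seq a u v && (x u && x v) | u <- vs, v <- vs]).

(** Here [w] stands for the activation bits that follow the team; the induced subgraph depends on
    the team alone. *)
Lemma gmachine_computes (I : Type) (a : I -> I -> bool) (x : I -> bool)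
    (vs : seq I) (k : nat) (w : word) :
  exists2 time, time <= 50 * (size vs + k + size vs * size vs).+1 &
    tm_computes_in (tm4 SkipN ghalt gdelta)
      ((enc_nat (size vs) ++ enc_nat k ++
        map Some [seq a u v | u <- vs, v <- vs]) ++
        None :: map Some (map x vs) ++ w) time (gword a x vs).
Proof.
set n := size vs.
have size_adj (b : I -> I -> bool) : size [seq b u v | u <- vs, v <- vs] = n * n.
  by rewrite size_allpairs.
suff: exists T U V, reach (step4 ghalt gdelta)
    (n.+1 + (n.+1 + (k.+1 + ((n * n).+1 + (n.+1 + (n.+1 + (n.+1 + ((n * n).+1 +
      ((n * (2 * n + 3)).+1 + (n + n * n).+1)))))))))
    (SkipN, tp [::] (map Some ((enc_nat n ++ enc_nat k ++
        map Some [seq a u v | u <- vs, v <- vs]) ++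
        None :: map Some (map x vs) ++ w)),
      tp [::] [::], tp [::] [::], tp [::] [::])
    (GHalt, T, U, V, tp [:: blank] (map Some (gword a x vs) ++ [:: blank])).
  move=> [T [U [V run]]].
  have [time le_t comp] := tm4_computes run isT.
  by exists time => //; apply: leq_trans le_t _; rewrite mulnDr; nia.
have -> : map Some ((enc_nat n ++ enc_nat k ++
        map Some [seq a u v | u <- vs, v <- vs]) ++
        None :: map Some (map x vs) ++ w) = nseq n tick ++ hash ::
     nseq k tick ++ hash :: bits [seq a u v | u <- vs, v <- vs] ++ hash ::
     bits (map x vs) ++ map Some w.
  by rewrite !(map_cat, map_rcons, map_nseq) -!cats1 -!catA /= map_cat.
suff [T [U [V run]]] : exists T U V,
   greach ((n * n).+1 + (n.+1 + (n.+1 + (n.+1 + ((n * n).+1 +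
      ((n * (2 * n + 3)).+1 + (n + n * n).+1))))))
   (SkipAdj, tp (hash :: nseq k tick ++ hash :: nseq n tick)
      (bits [seq a u v | u <- vs, v <- vs] ++ hash :: bits (map x vs) ++ map Some w),
    tp [:: None] (nseq n tick ++ [:: None]), tp [:: None] (nseq n tick ++ [:: None]),
    tp [::] [::])
   (GHalt, T, U, V, tp [:: blank] (map Some (gword a x vs) ++ [:: blank])).
  exists T, U, V.
  apply: reach_trans (greach_SkipN _ _ _ _ _ _) _.
  rewrite !cats0; apply: reach_trans (greach_RewindVW _ _ _ _ _) _.
  by apply: reach_trans (greach_SkipK _ _ _ _ _ _) _.
have size_x : size (map x vs) = n by rewrite size_map.
(* The tapes after the team is copied and the heads are back. The cell after the team has been
   rewritten in place, which makes a blank explicit when [w] is empty. *)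
have [T [U [V]]] := greach_Row a x vs vs
  (hash :: nseq k tick ++ hash :: nseq n tick)
  (hash :: bits (map x vs) ++ head None (map Some w) :: behead (map Some w))
  [::] [:: None] (catrev (bits (map x vs)) [::]).
set out := catrev _ (catrev _ _); rewrite catrevE -!map_rev.
have -> : out = map Some (rev (gword a x vs)).
  by rewrite /out /gword !catrevE cats0 -!rev_cat map_rev !map_cat.
move=> row.
have rewind := greach_GRewind (rev (gword a x vs)) T U V [:: None].
rewrite size_rev catrevE -map_rev revK size_map size_cat size_x size_adj
  in rewind.
have adj := greach_SkipAdj [seq a u v | u <- vs, v <- vs].
have copy := greach_CopyX (map x vs).
(* Backward passes meet the words reversed, whence the instances at [rev]. *)
have rx := @greach_RewindX (map x (rev vs)) (map x (rev vs)).
have bx := greach_BackX (map x (rev vs)).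
have badj := greach_BackAdj (rev [seq a u v | u <- vs, v <- vs]).
rewrite ?size_rev size_adj in adj badj; rewrite size_x in copy.
rewrite size_map size_rev in rx bx.
exists T, U, V.
apply: reach_trans (adj _ _ _ _ _) _.
apply: reach_trans (copy _ _ _ _ _ _ _) _.
rewrite !catrevE -!map_rev.
apply: reach_trans (rx _ _ _ _ _ _ (erefl _)) _.
rewrite catrevE -!map_rev revK.
apply: reach_trans (bx _ _ _ _ _) _.
rewrite catrevE -!map_rev revK.
apply: reach_trans (badj _ _ _ _ _) _.
rewrite catrevE -!map_rev revK.
exact: reach_trans row rewind.
Qed.

(** * Induced subgraphs *)

Lemma induced_sub (G : graph) (S : {set 'I_(order G)}) :
  [set e in edges G | e \subset S] \subset edges G.
Proof. by apply/subsetP => e; rewrite inE => /andP[]. Qed.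

Lemma induced_in (G : graph) (S : {set 'I_(order G)}) e :
  e \in [set e in edges G | e \subset S] -> e \subset S.
Proof. by rewrite inE => /andP[]. Qed.

Definition induced (G : graph) (S : {set 'I_(order G)}) : subgraph G :=
  Subgraph (induced_sub S) (@induced_in G S).

(** Reduces maximization over subgraphs to maximization over vertex sets. *)
Lemma leq_sedges_induced (G : graph) (H : subgraph G) :
  #|sedges H| <= #|sedges (induced (sverts H))|.
Proof.
apply/subset_leq_card/subsetP => e eH.
by rewrite inE (subsetP (sedges_sub H)) ?sedges_in.
Qed.

Lemma subset_sedges_induced (G : graph) (S T : {set 'I_(order G)}) :
  S \subset T -> #|sedges (induced S)| <= #|sedges (induced T)|.
Proof.
move=> sST; apply/subset_leq_card/subsetP => e; rewrite !inE.
by case/andP=> -> /subset_trans->.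
Qed.

Lemma mem_sedges_induced (G : graph) (S : {set 'I_(order G)}) u v :
  ([set u; v] \in sedges (induced S)) =
  ([set u; v] \in edges G) && ((u \in S) && (v \in S)).
Proof. by rewrite inE subUset !sub1set. Qed.

(** For [k > 0] both densities have the same positive denominator. *)
Lemma max_density_edges (G : graph) (k : nat) (H : subgraph G) :
  max_density_subgraph k H <-> max_edges_subgraph k H.
Proof.
suff dens (H' H'' : subgraph G) : #|sverts H'| = k -> #|sverts H''| = k ->
    (density H' <= density H'')%R = (#|sedges H'| <= #|sedges H''|).
  by split=> -[cardH maxH]; split=> // H' cardH'; move: (maxH _ cardH');
    rewrite dens.
move=> cardH' cardH''; rewrite /density cardH' cardH''.
(* For [k = 0] the densities are 0 by convention, and there are no edges, since an edge has two
   vertices. *)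
case: k => [|k] in cardH' cardH'' *.
  have no_edge (H0 : subgraph G) : #|sverts H0| = 0 -> #|sedges H0| = 0.
    move=> /cards0_eq H0_0; apply: eq_card0 => e; apply/negP => eH0.
    have := sedges_in eH0; rewrite H0_0 subset0 => /eqP e0.
    by have := edges_card2 (subsetP (sedges_sub H0) _ eH0); rewrite e0 cards0.
  by rewrite !no_edge // lexx.
by rewrite ler_pM2r ?ler_nat // invr_gt0 ltr0n.
Qed.

(** Double counting: every edge arises from exactly two ordered pairs, and a diagonal pair gives a
    singleton, which is not an edge. *)
Lemma sum_pairs_card2 (T : finType) (E : {set {set T}}) :
  (forall e, e \in E -> #|e| = 2) ->
  \sum_(u : T) \sum_(v : T) ([set u; v] \in E) = 2 * #|E|.
Proof.
move=> card2E; rewrite pair_big /=.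
transitivity (\sum_(p : T * T) \sum_(e in E) (e == [set p.1; p.2])).
  apply: eq_bigr => p _; have [pE|pE] := boolP (_ \in E).
    by rewrite (bigD1 _ pE) eqxx big1 // => e /andP[_ /negPf->].
  by rewrite big1 // => e eE; case: eqP pE => // <-; rewrite eE.
rewrite exchange_big /= mulnC -sum_nat_const; apply: eq_bigr => e /card2E /eqP.
case/cards2P=> a [b [neq_ab ->]].
(* The pairs giving the edge with ends [a] and [b]; they are distinct because [a != b]. *)
transitivity #|[set (a, b); (b, a)]|.
  rewrite -sum1_card [RHS]big_mkcond; apply: eq_bigr => -[u v] _ /=.
  rewrite !inE !xpair_eqE; case: eqVneq => [eq_uv|neq].
    have /set2P[uE|uE] : u \in [set a; b] by rewrite eq_uv set21.
      have /set2P[ba|<-] : b \in [set u; v] by rewrite -eq_uv set22.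
        by rewrite ba uE eqxx in neq_ab.
      by rewrite uE !eqxx.
    have /set2P[ab|<-] : a \in [set u; v] by rewrite -eq_uv set21.
      by rewrite ab uE eqxx in neq_ab.
    by rewrite uE !eqxx orbT.
  case: ifP => // /orP[]/andP[/eqP uE /eqP vE]; move: neq.
    by rewrite uE vE eqxx.
  by rewrite uE vE setUC eqxx.
rewrite cards2 xpair_eqE (negPf neq_ab).
by [].
Qed.

(** * The reduction *)

Lemma sum_eq_leq1 n (j : 'I_n) : \sum_(i < n) (i == j) <= 1.
Proof. by rewrite (bigD1 j) //= eqxx big1 // => i /negPf->. Qed.

Definition du_of_dks (x : dks_inst) : du_inst rat :=
  let n := order (dks_graph x) in
  @DuInst rat n (dks_k x) n 1 (fun=> 1%R) (fun i j => i == j) (@sum_eq_leq1 n)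
    (fun i j _ => ([set i; j] \in edges (dks_graph x))%:R%R).

(** * Optimal teams induce densest subgraphs *)

Section Optimal.
Variables (R : realType) (M : nat -> R).
Hypothesis hM : forall q : nat, (q%:R < M q)%R.
Variable x : dks_inst.
Notation n := (order (dks_graph x)).
Notation E := (edges (dks_graph x)).
Notation dsol := (du_sol (map_du (@ratr R) (du_of_dks x))).

Definition team (y : dsol) : {set 'I_n} := [set i | y.1 i].

(** A decidable form without [M]: activating the bonus of [i] for [j] amounts to having both in the
    team. *)
Definition feasible_bool (y : dsol) : bool :=
  (#|team y| <= dks_k x) &&
  [forall i : 'I_n, forall j : 'I_n,
     y.2 (i, j, ord0) ==> (i \in team y) && (j \in team y)].

Lemma feasibleP (y : dsol) : reflect (du_feasible M y) (feasible_bool y).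
Proof.
have sum_team : \sum_(i < n) y.1 i = #|team y|.
  by rewrite -sum1_card [RHS]big_mkcond; apply: eq_bigr => i _; rewrite inE; case: y.1.
(* The alliance [j] has the single member [j], so its count in the team is [x_j]. *)
have sum_j (j : 'I_n) : (\sum_(i < n) (i == j)%:R * (y.1 i)%:R = (y.1 j)%:R :> R)%R.
  rewrite (bigD1 j) //= eqxx mul1r big1 ?addr0 // => i /negPf->.
  by rewrite mul0r.
apply: (iffP andP) => [[le_k /forallP act] | [le_k actl actr]].
  have {}act i j : y.2 (i, j, ord0) -> y.1 i && y.1 j.
    by move: (act i) => /forallP/(_ j); rewrite !inE => /implyP.
  split=> [|i j k|i j k]; first by rewrite /= sum_team.
    rewrite (ord1 k); have := act i j.
    by case: (y.2 _) => // /(_ isT)/andP[->].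
  rewrite (ord1 k) /= sum_j; have := act i j.
  case: (y.2 _) => [/(_ isT)/andP[_ ->]|_]; first by rewrite /= !mulr1n subrr mulr0.
  (* For an inactive bonus the constraint reads [- M 1 <= x_j - 1], which follows from [1 < M 1]. *)
  rewrite /= mulr0n sub0r mulrN1; have := hM 1.
  case: (y.1 j) => M1; rewrite /= mulr1n ?mulr0n ?subrr ?sub0r ?lerN2 ?oppr_le0 ltW //.
  exact: lt_trans M1.
split; first by rewrite -sum_team.
apply/forallP => i; apply/forallP => j; apply/implyP => yij.
rewrite !inE; have := actl i j ord0; have := actr i j ord0.
(* For an active bonus it reads [1 <= x_j]. *)
rewrite /= sum_j yij mulr1n subrr mulr0 subr_ge0.
by case: (y.1 j); rewrite ?mulr0n ?ler10 //; case: (y.1 i).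
Qed.

(** All data are 0 or 1, so the objective is a natural number and can be maximized in [nat]. *)
Definition value_nat (y : dsol) : nat :=
  #|team y| + \sum_(i < n) \sum_(j < n) (([set i; j] \in E) && y.2 (i, j, ord0)).

Lemma du_valueE (y : dsol) : du_value y = (value_nat y)%:R%R.
Proof.
rewrite /du_value /value_nat natrD -sum1_card !natr_sum; congr (_ + _)%R.
  rewrite [RHS]big_mkcond; apply: eq_bigr => i _ /=.
  by rewrite rmorph1 mulr1 inE; case: (y.1 i).
apply: eq_bigr => i _ /=; rewrite natr_sum; apply: eq_bigr => j _.
rewrite big_ord1 /=; rewrite ratr_nat -natrM.
by case: (_ \in _); case: (y.2 _).
Qed.

Lemma du_optimalP (y : dsol) : du_optimal M y <->
  feasible_bool y /\ forall y', feasible_bool y' -> value_nat y' <= value_nat y.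
Proof.
split=> -[/feasibleP fy opt]; split=> // y' /feasibleP/opt.
  by rewrite !du_valueE ler_nat.
by rewrite !du_valueE ler_nat.
Qed.

(** There are finitely many assignments, and the empty team is feasible. *)
Lemma du_optimal_exists : exists y : dsol, du_optimal M y.
Proof.
pose y0 : dsol := ([ffun=> false], [ffun=> false]).
have fy0 : feasible_bool y0.
  rewrite /feasible_bool (_ : team y0 = set0) ?cards0 /=; last first.
    by apply/setP => i; rewrite !inE ffunE.
  by apply/forallP => i; apply/forallP => j; rewrite ffunE.
case: (arg_maxnP value_nat fy0) => y fy maxy.
by exists y; apply/du_optimalP; split=> // y' /maxy.
Qed.

(** Activates every bonus that the team [T] allows, so that the bound of [leq_value] is attained. *)
Definition team_sol (T : {set 'I_n}) : dsol :=
  ([ffun i => i \in T], [ffun p => (p.1.1 \in T) && (p.1.2 \in T)]).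

Lemma team_team_sol (T : {set 'I_n}) : team (team_sol T) = T.
Proof. by apply/setP => i; rewrite inE ffunE. Qed.

Lemma feasible_team_sol (T : {set 'I_n}) : #|T| <= dks_k x -> feasible_bool (team_sol T).
Proof.
move=> leT; rewrite /feasible_bool team_team_sol leT /=.
by apply/forallP => i; apply/forallP => j; rewrite ffunE; apply/implyP.
Qed.

Lemma sum_induced (T : {set 'I_n}) :
  \sum_(i < n) \sum_(j < n) (([set i; j] \in E) && ((i \in T) && (j \in T))) =
  2 * #|sedges (induced T)|.
Proof.
rewrite -sum_pairs_card2 => [|e]; last by rewrite inE => /andP[/edges_card2].
by apply: eq_bigr => i _; apply: eq_bigr => j _; rewrite mem_sedges_induced.
Qed.

Lemma value_team_sol (T : {set 'I_n}) :
  value_nat (team_sol T) = #|T| + 2 * #|sedges (induced T)|.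
Proof.
rewrite /value_nat team_team_sol -sum_induced; congr (_ + _).
by apply: eq_bigr => i _; apply: eq_bigr => j _; rewrite ffunE.
Qed.

Lemma leq_value (y : dsol) : feasible_bool y ->
  value_nat y <= #|team y| + 2 * #|sedges (induced (team y))|.
Proof.
case/andP=> _ /forallP act; rewrite leq_add2l -sum_induced.
apply: leq_sum => i _; apply: leq_sum => j _.
have /forallP/(_ j) := act i.
by case: (_ \in E); case: (y.2 _) => //= ->.
Qed.

Lemma du_optimal_max_edges (y : dsol) :
  du_optimal M y -> max_edges_subgraph (dks_k x) (induced (team y)).
Proof.
move=> /du_optimalP[fy opt].
have opt_team (T : {set 'I_n}) : #|T| <= dks_k x ->
    #|T| + 2 * #|sedges (induced T)| <=
    #|team y| + 2 * #|sedges (induced (team y))|.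
  move=> leT; rewrite -value_team_sol.
  exact: leq_trans (opt _ (feasible_team_sol leT)) (leq_value fy).
(* A smaller team could be enlarged: as [k <= n] a vertex is left over, and adding it gains strength
   1 and loses no edge. *)
have card_team : #|team y| = dks_k x.
  have /andP[le_k _] := fy; apply/eqP; rewrite eqn_leq le_k leqNgt.
  apply/negP => lt_k.
  have [v vT] : exists v, v \notin team y.
    apply/existsP; rewrite -negb_forall; apply: contraL lt_k => /forallP allT.
    rewrite -leqNgt (leq_trans (dks_k_le x)) //.
    by rewrite (eq_card (B := predT)) ?card_ord //; apply/allT.
  have := opt_team (v |: team y); rewrite cardsU1 vT => /(_ lt_k).
  by have := subset_sedges_induced (subsetUr [set v] (team y)); lia.
split=> // H' cardH'; apply: leq_trans (leq_sedges_induced H') _.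
by have := opt_team (sverts H'); rewrite cardH' card_team leqnn => /(_ isT); lia.
Qed.

End Optimal.

(** * Encodings *)

Lemma enc_fam_bool n (F : 'I_n -> bool) :
  enc_fam (fun u => enc_bool (F u)) = map Some (map F (enum 'I_n)).
Proof. by rewrite /enc_fam -map_comp; elim: (enum _) => //= u s ->. Qed.

Lemma enc_fam_pairs n (a : 'I_n -> 'I_n -> bool) (c : bool -> word) :
  enc_fam (fun u => enc_fam (fun v => c (a u v))) =
  flatten (map c [seq a u v | u <- enum 'I_n, v <- enum 'I_n]).
Proof.
suff pairs us vs : flatten [seq flatten [seq c (a u v) | v <- vs] | u <- us] =
    flatten (map c [seq a u v | u <- us, v <- vs]) by exact: pairs.
by elim: us => //= u us ->; rewrite map_cat flatten_cat -map_comp.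
Qed.

Lemma enc_fam_pairs_bool n (a : 'I_n -> 'I_n -> bool) :
  enc_fam (fun u => enc_fam (fun v => enc_bool (a u v))) =
  map Some [seq a u v | u <- enum 'I_n, v <- enum 'I_n].
Proof. by rewrite enc_fam_pairs; elim: [seq a u v | u <- _, v <- _] => //= b s ->. Qed.

Lemma enc_fam_ord1 (F : 'I_1 -> word) : enc_fam F = F ord0.
Proof. by rewrite /enc_fam enum_ordSl (size0nil (size_enum_ord 0)) /= cats0. Qed.

Lemma enc_rat_bool (b : bool) :
  enc_rat b%:R%R = if b then rat1_word else rat0_word.
Proof. by case: b. Qed.

(* The zeros appended on the left complete the last period. *)
Lemma identity_rows n (m : nat) : m <= n ->
  flatten [seq [seq i == j | j <- iota 0 n] | i <- iota 0 m] ++ nseq m false =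
  flatten (nseq m (true :: nseq n false)).
Proof.
elim: m => // m IHm lt_mn; rewrite -{1}addn1 iotaD map_cat flatten_cat /= cats0.
have row_m : [seq m == j | j <- iota 0 n] =
    nseq m false ++ true :: nseq (n - m.+1) false.
  have row0 s : m \notin s -> [seq m == j | j <- s] = nseq (size s) false.
    by elim: s => //= j s IHs; rewrite inE negb_or => /andP[/negPf-> /IHs->].
  rewrite -{1}(subnKC (ltnW lt_mn)) iotaD map_cat -subnSK //= add0n eqxx.
  rewrite !row0 ?mem_iota ?size_iota //; lia.
(* The first [m] zeros of row [m] complete the previous period; its last zeros and the [m + 1]
   appended ones make up the [n] zeros of a new one. *)
rewrite row_m -!catA cat_cons -[false :: _]/(nseq m.+1 false) -nseqD subnK //.
rewrite -[RHS]/(flatten (nseq m.+1 (true :: nseq n false))).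
by rewrite -addn1 nseqD flatten_cat -(IHm (ltnW lt_mn)) -!catA /= cats0.
Qed.

Lemma enc_fam_const n (c : word) : enc_fam (fun _ : 'I_n => c) = flatten (nseq n c).
Proof.
by rewrite /enc_fam -[n in RHS]size_enum_ord; elim: (enum _) => //= i s ->.
Qed.

Lemma identity_word n : [seq i == j | i <- enum 'I_n, j <- enum 'I_n] =
  flatten (nseq n.-1 (true :: nseq n false)) ++ nseq (n > 0) true.
Proof.
transitivity [seq i == j | i <- iota 0 n, j <- iota 0 n].
  by rewrite -val_enum_ord [RHS]allpairs_mapl [RHS]allpairs_mapr.
(* With all the rows taken, both sides end in the same block of zeros, which is cancelled by
   comparing lengths. *)
case: n => // n; have := identity_rows (leqnn n.+1).
rewrite -{4}addn1 nseqD flatten_cat [flatten [:: _]]cats0 -cat1s catA => eq_cat.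
move: (congr1 size eq_cat) => /eqP; rewrite !(size_cat _ (nseq _ false)).
rewrite eqn_add2r => /eqP eq_size; move/eqP: eq_cat.
by rewrite (eqseq_cat _ _ eq_size) eqxx andbT => /eqP.
Qed.

Lemma enc_du_of_dks (x : dks_inst) :
  enc_du_inst (du_of_dks x) =
  fword (order (dks_graph x)) (dks_k x) [seq [set u; v] \in edges (dks_graph x) |
    u <- enum 'I_(order (dks_graph x)), v <- enum 'I_(order (dks_graph x))].
Proof.
rewrite /enc_du_inst /fword /= enc_fam_pairs_bool identity_word enc_fam_const.
rewrite -enc_fam_pairs (enc_rat_bool true).
suff entries i j : enc_fam (fun _ : 'I_1 =>
    enc_rat ([set i; j] \in edges (dks_graph x))%:R%R) =
    if [set i; j] \in edges (dks_graph x) then rat1_word else rat0_word.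
  congr (_ ++ (_ ++ (_ ++ (_ :: (_ :: (_ ++ (_ ++ flatten _))))))).
  by apply: eq_map => i; congr flatten; apply: eq_map.
by rewrite enc_fam_ord1 enc_rat_bool.
Qed.

(** * Polynomial running time of both translations *)

(** The adjacency matrix contributes [n * n] symbols, so time quadratic in [n] is linear in the
    input. *)
Lemma size_enc_dks_inst (x : dks_inst) (n := order (dks_graph x)) :
  size (enc_dks_inst x) = (n + dks_k x + n * n).+2.
Proof.
rewrite /enc_dks_inst /enc_adj enc_fam_pairs_bool !size_cat !size_rcons.
rewrite !size_nseq size_map size_allpairs size_enum_ord /n; lia.
Qed.

Lemma polytime_du_of_dks : polytime enc_dks_inst enc_du_inst du_of_dks.
Proof.
(* The factor 50 doubles because [n * n] occurs twice in the time bound, once as the length of the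
   matrix. *)
exists 3, (tm4 CopyN fhalt fdelta), 100, 1 => x.
pose n := order (dks_graph x).
have := fmachine_computes n (dks_k x)
  [seq [set u; v] \in edges (dks_graph x) | u <- enum 'I_n, v <- enum 'I_n].
rewrite size_allpairs size_enum_ord -enc_du_of_dks => -[time le_t comp].
exists time.
  by rewrite expn1 size_enc_dks_inst; apply: leq_trans le_t _; rewrite /n; lia.
by rewrite /enc_dks_inst /enc_adj enc_fam_pairs_bool.
Qed.

Lemma polytime_induced_team (R : realType) :
  polytime
    (fun u : {x : dks_inst & du_sol (map_du (@ratr R) (du_of_dks x))} =>
       enc_dks_inst (tag u) ++ None :: enc_du_sol (tagged u))
    (fun v : {x : dks_inst & subgraph (dks_graph x)} => enc_subgraph (tagged v))
    (fun u => Tagged (fun x => subgraph (dks_graph x)) (induced (team (tagged u)))).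
Proof.
exists 3, (tm4 SkipN ghalt gdelta), 50, 1 => -[x y].
set n := order (dks_graph x).
have [time le_t comp] := gmachine_computes
  (fun u v : 'I_n => [set u; v] \in edges (dks_graph x))
  (fun u => y.1 u) (enum 'I_n) (dks_k x)
  (enc_fam (fun i : 'I_n => enc_fam (fun j : 'I_n => enc_fam (fun k : 'I_1 =>
    enc_bool (y.2 (i, j, k)))))).
exists time.
  apply: leq_trans le_t _; apply: leq_trans (leq_addr _ _).
  rewrite leq_mul2l expn1 size_cat size_enc_dks_inst size_enum_ord -/n.
  by apply: leq_trans (leq_addr _ _).
rewrite size_enum_ord in comp.
rewrite /= /enc_dks_inst /enc_du_sol /enc_adj enc_fam_pairs_bool /=.
rewrite [enc_fam (fun i => enc_bool (y.1 i))]enc_fam_bool.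
suff <- : gword (fun u v : 'I_n => [set u; v] \in edges (dks_graph x))
  (fun u => y.1 u) (enum 'I_n) = enc_subgraph (induced (team y)) by [].
rewrite /enc_subgraph /enc_adj enc_fam_bool enc_fam_pairs_bool -map_cat.
congr (map Some (_ ++ _)).
  by apply: eq_map => u; rewrite inE.
by apply: eq_allpairs => u v; rewrite mem_sedges_induced !inE.
Qed.

Theorem theorem1 (R : realType) (M : nat -> R)
    (hM : forall q : nat, (q%:R < M q)%R) :
  (forall (G : graph) (k : nat) (H : subgraph G),
     max_density_subgraph k H <-> max_edges_subgraph k H) /\
  poly_reducible densest_k_subgraph (dota_underlords M).
Proof.
split; first exact: max_density_edges.
exists du_of_dks, (fun x y => induced (team y)).
split=> [||x _|x y /(du_optimal_max_edges hM)/max_density_edges //].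
- exact: polytime_du_of_dks.
- exact: polytime_induced_team.
- exact: du_optimal_exists.
Qed.
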